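(* Let $\Gamma$ be a finite simple graph, and let $P$ be a locally finite poset equipped with a surjective coloring function $\kappa:P\to\Gamma$. The following are equivalent: (i) The lattice $\mathcal{FI}(P)$ carries an $X$-square nilpotent representation of $\mathfrak{n}_+$. (ii) The properties EC, NA, and I3ND are satisfied by $P$. (iii) The lattice $\mathcal{FI}(P)$ carries a $Y$-square nilpotent representation of $\mathfrak{n}_-$.
   Context: Graph and poset. $\Gamma$ has no loops or multiple edges; its vertex set is also denoted $\Gamma$ and its vertices are called colors. For $a,b\in\Gamma$, $a\sim b$ means $\{a,b\}$ is an edge (adjacent); $a,b$ are distant if $a\ne b$ and $\{a,b\}$ is not an edge. Locally finite means every closed interval of $P$ is finite. $x\to y$ means $x$ is covered by $y$; $x,y$ are neighbors if $x\to y$ or $y\to x$. A filter is an upwardly closed subset, an ideal a downwardly closed subset. A split is a pair $(F,I)$ with $F$ a filter and $I=P-F$; $\mathcal{FI}(P)$ is the set of all splits, ordered by inclusion of ideals. Write $(F-x,I+x)$ for $(F\setminus\{x\},I\cup\{x\})$ and $(F+y,I-y)$ for $(F\cup\{y\},I\setminus\{y\})$. Operators. $V=\langle\mathcal{FI}(P)\rangle$ is the free complex vector space with basis $\{\langle F,I\rangle\}_{(F,I)\in\mathcal{FI}(P)}$. For $a\in\Gamma$ define linearly $X_a.\langle F,I\rangle=\sum\langle F-x,I+x\rangle$, summed over the elements $x$ of color $a$ minimal in $F$, and $Y_a.\langle F,I\rangle=\sum\langle F+y,I-y\rangle$, summed over the elements $y$ of color $a$ maximal in $I$. Any assertion about these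 operators is understood to include that the defining sums are finite, so that the operators are well defined. (Finiteness is automatic when EC holds.) $X$-square (respectively $Y$-square) nilpotent means $X_a^2=0$ (respectively $Y_a^2=0$) for all $a$. Lie algebras and representations. $\mathfrak{n}_+$ is the complex Lie algebra generated by $\{x_a\}_{a\in\Gamma}$ subject to $[x_b,x_a]=0$ for $a,b$ distant and $[x_a,[x_a,x_b]]=0$ for all $a,b\in\Gamma$. $\mathfrak{n}_-$ is generated by $\{y_a\}_{a\in\Gamma}$ subject to the same relations with $y$ in place of $x$. $\mathcal{FI}(P)$ carries a representation of $\mathfrak{n}_+$ (respectively $\mathfrak{n}_-$) if the operators $X_a$ (respectively $Y_a$), giving the actions of the $x_a$ (respectively $y_a$), satisfy these relations with respect to the commutator on $\mathrm{End}(V)$. Coloring properties. EC: elements with equal colors are comparable. NA: neighbors have adjacent colors. I3ND: if three successive neighbors $x\to y\to z$ form an interval in $P$ (i.e. $[x,z]=\{x,y,z\}$), then $x$ and $z$ have different colors. *)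

(* Defs.v *)
From HB Require Import structures.
From mathcomp Require Import all_boot all_order all_algebra.
From mathcomp Require Import all_classical all_reals.
From mathcomp Require Export freeg complex.

Set Implicit Arguments.
Unset Strict Implicit.
Unset Printing Implicit Defensive.

Import Order.TTheory GRing.Theory.

Local Open Scope classical_set_scope.
Local Open Scope ring_scope.

Definition locally_finite_poset (d : Order.disp_t) (P : porderType d) : Prop :=
  forall x y : P, finite_set [set z | x <= z <= y]%O.

Section Poset.
Context {d : Order.disp_t} {P : porderType d}.
Implicit Types (x y z : P) (A : set P).

Definition covered_by x y : Prop :=
  (x < y)%O /\ ~ exists z, (x < z < y)%O.

Definition neighbors x y : Prop := covered_by x y \/ covered_by y x.

Definition is_filter A : Prop := forall x y, (x <= y)%O -> A x -> A y.

Definition minimal_in A x : Prop := A x /\ forall y, A y -> (y <= x)%O -> y = x.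

Definition maximal_in A x : Prop := A x /\ forall y, A y -> (x <= y)%O -> y = x.

Definition is_split (p : set P * set P) : Prop :=
  is_filter p.1 /\ p.2 = ~` p.1.

End Poset.

Record FI (d : Order.disp_t) (P : porderType d) := Split {
  split_pair : set P * set P;
  split_pairP : `[< is_split split_pair >]
}.

HB.instance Definition _ (d : Order.disp_t) (P : porderType d) :=
  [isSub for @split_pair d P].
HB.instance Definition _ (d : Order.disp_t) (P : porderType d) :=
  [Choice of FI P by <:].

Section Splits.
Context {d : Order.disp_t} {P : porderType d}.
Implicit Types (s : FI P) (x y : P).

Definition split_filter s : set P := (split_pair s).1.
Definition split_ideal s : set P := (split_pair s).2.

Lemma split_filterP s : is_filter (split_filter s).
Proof. by case/asboolP: (split_pairP s). Qed.

Lemma split_idealE s : split_ideal s = ~` split_filter s.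
Proof. by case/asboolP: (split_pairP s). Qed.

(* The splits (F - x, I + x) and (F + y, I - y). When the displayed pair is   *)
(* not a split the value is the junk value s; move_downE and move_upE show    *)
(* that this never happens for the x and y occurring in X_a and Y_a.          *)
Definition move_down s x : FI P :=
  insubd s (split_filter s `\ x, x |` split_ideal s).

Definition move_up s y : FI P :=
  insubd s (y |` split_filter s, split_ideal s `\ y).

Lemma move_downE s x : minimal_in (split_filter s) x ->
  split_pair (move_down s x) = (split_filter s `\ x, x |` split_ideal s).
Proof.
case=> Fx minx; rewrite [LHS]val_insubd ifT//; apply/asboolP; split.
  move=> u v /= uv [Fu ux]; split; first exact: split_filterP uv Fu.
  by move=> vx; apply: ux; apply: minx => //; rewrite -vx.
rewrite /= split_idealE; apply/seteqP; split=> u; rewrite /setC /=.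
  by case=> [-> [_ nxx]|nFu [Fu _]]; [apply: nxx|apply: nFu].
by move=> nFu; have [->|ux] := pselect (u = x); [left|right=> Fu; apply: nFu].
Qed.

Lemma move_upE s y : maximal_in (split_ideal s) y ->
  split_pair (move_up s y) = (y |` split_filter s, split_ideal s `\ y).
Proof.
case=> Iy maxy; rewrite [LHS]val_insubd ifT//; apply/asboolP; split.
  move=> u v /= uv [uy|Fu]; last by right; exact: split_filterP uv Fu.
  have [Fv|nFv] := pselect (split_filter s v); first by right.
  by left; apply: maxy; rewrite ?split_idealE// -uy.
rewrite /= split_idealE; apply/seteqP; split=> u; rewrite /setC /=.
  by move=> [nFu uy] [].
by move=> /not_orP[].
Qed.

End Splits.

Section Coloring.
Context {d : Order.disp_t} {P : porderType d} {G : finType}.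
Variables (adj : rel G) (kappa : P -> G).

Definition EC : Prop := forall x y : P, kappa x = kappa y -> (x >=< y)%O.

Definition NA : Prop :=
  forall x y : P, neighbors x y -> adj (kappa x) (kappa y).

Definition I3ND : Prop := forall x y z : P,
  covered_by x y -> covered_by y z ->
  [set u | x <= u <= z]%O = [set x; y; z] -> kappa x != kappa z.

End Coloring.

Definition distant (G : finType) (adj : rel G) (a b : G) : bool :=
  (a != b) && ~~ adj a b.

Section LieRelations.
Context {K : pzRingType} {V : lmodType K}.

(* The parentheses matter: \- binds tighter than \o.                          *)
Definition commutator (f g : {linear V -> V}) : {linear V -> V} :=
  (f \o g) \- (g \o f).

(* The defining relations of n_+ (with Z = x) and of n_- (with Z = y).        *)
Definition n_relations (G : finType) (adj : rel G) (Z : G -> {linear V -> V}) :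
    Prop :=
  (forall a b, distant adj a b -> commutator (Z b) (Z a) =1 \0) /\
  (forall a b, commutator (Z a) (commutator (Z a) (Z b)) =1 \0).

Definition square_nilpotent (G : finType) (Z : G -> {linear V -> V}) : Prop :=
  forall a, Z a \o Z a =1 \0.

End LieRelations.

Section FreeModule.
Context {K : nzRingType} {B : choiceType} {M : lmodType K}.
Variable f : B -> M.

Let ext : {freeg B / K} -> M := fglift f.

Let ext_is_additive : zmod_morphism ext.
Proof. exact: lift_is_additive. Qed.

HB.instance Definition _ :=
  GRing.isZmodMorphism.Build {freeg B / K} M ext ext_is_additive.

Let ext_is_scalable : scalable ext.
Proof.
move=> c u; rewrite -[u]freeg_repr; set r := repr u : seq (K * B).
have -> : c *: Freeg r = Freeg [seq (c * z.1, z.2) | z <- r] :> {freeg B / K}.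
  apply/eqP/freeg_eqP => b.
  by rewrite coeffZ !coeff_Freeg /precoeff big_map mulr_sumr.
rewrite /ext !fglift_Freeg /prelift big_map scaler_sumr.
by apply: eq_bigr => z _; rewrite scalerA.
Qed.

HB.instance Definition _ :=
  GRing.isScalable.Build K {freeg B / K} M *:%R ext ext_is_scalable.

Definition linear_extension : {linear {freeg B / K} -> M} := ext.

Lemma linear_extensionE b : linear_extension << b >> = f b.
Proof. by rewrite [LHS]liftU scale1r. Qed.

End FreeModule.

Definition V (R : realType) {d : Order.disp_t} (P : porderType d) :
    lmodType R[i] := {freeg (FI P) / (R[i])}.

Section Operators.
Context (R : realType) {d : Order.disp_t} {P : porderType d} {G : finType}.
Variable kappa : P -> G.

Definition X_elements (a : G) (s : FI P) : set P :=
  [set x | kappa x = a /\ minimal_in (split_filter s) x].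

Definition Y_elements (a : G) (s : FI P) : set P :=
  [set y | kappa y = a /\ maximal_in (split_ideal s) y].

(* The sums below are 0 by convention when infinite, hence the finiteness     *)
(* clauses in the two carries_ predicates.                                    *)
Definition X (a : G) : {linear V R P -> V R P} :=
  linear_extension
    (fun s => \sum_(x \in X_elements a s) (<< move_down s x >> : V R P)).

Definition Y (a : G) : {linear V R P -> V R P} :=
  linear_extension
    (fun s => \sum_(y \in Y_elements a s) (<< move_up s y >> : V R P)).

Lemma X_basis a s : X a (<< s >> : V R P) =
  \sum_(x \in X_elements a s) (<< move_down s x >> : V R P).
Proof. exact: linear_extensionE. Qed.

Lemma Y_basis a s : Y a (<< s >> : V R P) =
  \sum_(y \in Y_elements a s) (<< move_up s y >> : V R P).
Proof. exact: linear_extensionE. Qed.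

Definition carries_square_nilpotent_X_rep (adj : rel G) : Prop :=
  [/\ forall a s, finite_set (X_elements a s),
      n_relations adj X
    & square_nilpotent X].

Definition carries_square_nilpotent_Y_rep (adj : rel G) : Prop :=
  [/\ forall a s, finite_set (Y_elements a s),
      n_relations adj Y
    & square_nilpotent Y].

End Operators.

(* Main.v *)
Require Import Defs.
From mathcomp Require Import all_boot all_order all_algebra.
From mathcomp Require Import all_classical all_reals.

Set Implicit Arguments.
Unset Strict Implicit.
Unset Printing Implicit Defensive.

Import Order.TTheory GRing.Theory Num.Theory.

Local Open Scope classical_set_scope.
Local Open Scope ring_scope.

(** Everything reduces to which elements can be removed one after another from
a filter.  Applying X_a, then X_b, then ... to a basis vector <F, I> gives a sum
of basis vectors, one for each way to remove successively a minimal element of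
color a, then one of color b, and so on.  All coefficients are natural numbers,
so in characteristic 0 nothing cancels: such an iterated application vanishes
exactly when no removal sequence with those colors exists
([basis_sum_eq0], [X_path2_neq0], [X_path3_neq0]).  When all the X_a square to
zero, the Serre relation [X_a, [X_a, X_b]] = 0 reads -2 X_a X_b X_a = 0
([serre_square_nilpotent]), so it too is a statement on removal sequences.

From the relations to the coloring, each violation of a property produces a
forbidden removal sequence, starting from the filter generated by the elements
involved.  Two incomparable elements of the same color can be removed one after
the other, so X_a^2 <> 0.  If y covers x, then from the principal filter at x
one can remove x and then y, whereas only x can be removed first; hence the
colors a of x and b of y satisfy X_b X_a <> 0 on that vector, while X_a X_b = 0
on it if a <> b, which excludes a = b and a, b distant.  Finally a
three-element interval x -> y -> z with colors a, b, a yields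
X_a X_b X_a <> 0.

From the coloring to the relations, EC makes X_a <F, I> either 0 or a single
basis vector ([X_basis_cases]).  The key point is [minimal_in_setD1_inv]: an
element that is minimal once x has been removed was minimal before, or covers x.
Under NA the second case does not arise for equal or distant colors; this gives
X_a^2 = 0 by EC, and the commutation of distant colors because the two removals
may be done in either order.  A removal sequence x, y, z with colors a, b, a
has x < z by EC and nothing but y can lie between them, so that either z covers
x, against NA, or [x, z] = {x, y, z}, against I3ND ([X_aba_eq0]).

This proves the statement about X for every poset.  Exchanging filters and
ideals identifies the operators Y_a of P with the operators X_a of the dual
poset ([Y_representation_dual]), and the three coloring properties are
self-dual ([coloring_dual]), so the statement about Y follows. *)

(** * Linear algebra of free modules and of the relations *)

Section FreeModuleTheory.
Context {K : nzRingType} {B : choiceType}.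

Lemma linear_basis_ext (M : lmodType K) (f g : {linear {freeg B / K} -> M}) :
  (forall b, f << b >> = g << b >>) -> f =1 g.
Proof.
move=> fg u; rewrite -[u]freeg_sumE !linear_sum; apply: eq_bigr => b _.
have -> c : << c *g b >> = c *: << b >> :> {freeg B / K}.
  by apply/eqP/freeg_eqP => b'; rewrite coeffZ !coeffU mul1r.
by rewrite !linearZ fg.
Qed.

End FreeModuleTheory.

Section BasisSums.
Context {K : numDomainType} {B : choiceType}.

Definition basis_sum (l : seq B) : {freeg B / K} := \sum_(b <- l) << b >>.

(** The linear form that sends every basis vector to 1 takes the value [size l]
on such a sum, and natural numbers do not vanish in characteristic 0. *)
Lemma basis_sum_eq0 (l : seq B) : basis_sum l = 0 -> l = [::].
Proof.
pose augmentation : {linear {freeg B / K} -> K^o} :=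
  linear_extension (fun=> 1 : K^o).
move/(congr1 augmentation); rewrite linear0 linear_sum.
under eq_bigr do rewrite linear_extensionE.
rewrite big_const_seq count_predT iter_addr_0 => /eqP.
by rewrite pnatr_eq0 => /nilP.
Qed.

End BasisSums.

Section Relations.
Context {K : pzRingType} {V W : lmodType K} {G : finType}.
Implicit Types (adj : rel G) (Z : G -> {linear V -> V}).

Lemma commutatorE (f g : {linear V -> V}) v :
  commutator f g v = f (g v) - g (f v).
Proof. by []. Qed.

(** In the expansion X_a X_a X_b - 2 X_a X_b X_a + X_b X_a X_a only the middle
term survives. *)
Lemma serre_square_nilpotent Z a b v : square_nilpotent Z ->
  commutator (Z a) (commutator (Z a) (Z b)) v = - (Z a (Z b (Z a v)) *+ 2).
Proof.
move=> Z2; have Z2v c w : Z c (Z c w) = 0 by exact: Z2.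
by rewrite !commutatorE linearB !Z2v linear0 sub0r subr0 mulr2n opprD.
Qed.

(** Transport along an intertwining map [D]: the right inverse [D'] makes every
vector of [W] some [D v], and on [D v] the relations for [Z'] are the images of
those for [Z]. *)
Lemma conjugate_relations adj Z (Z' : G -> {linear W -> W})
    (D : {linear V -> W}) (D' : W -> V) :
  cancel D' D -> (forall a v, D (Z a v) = Z' a (D v)) ->
  n_relations adj Z /\ square_nilpotent Z ->
  n_relations adj Z' /\ square_nilpotent Z'.
Proof.
move=> D'K DZ [[dist serre] nil].
have DC (f g : {linear V -> V}) (f' g' : {linear W -> W}) :
    (forall v, D (f v) = f' (D v)) ->
    (forall v, D (g v) = g' (D v)) ->
  forall v, D (commutator f g v) = commutator f' g' (D v).
  by move=> Df Dg v; rewrite !commutatorE linearB !Df !Dg !Df.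
split; first split.
- move=> a b ab w; rewrite -[w]D'K -(DC (Z b) (Z a))//.
  by rewrite dist// linear0.
- move=> a b w; rewrite -[w]D'K -(DC (Z a) (commutator (Z a) (Z b)))//.
    by rewrite serre linear0.
  exact: DC.
- move=> a w; rewrite -[w]D'K /= -!DZ.
  by have /= -> := nil a (D' w); rewrite linear0.
Qed.

End Relations.

(** * Splits and minimal elements *)

Section SplitTheory.
Context {d : Order.disp_t} {P : porderType d}.
Implicit Types (x y z : P) (s t : FI P) (A F : set P).

Lemma split_ext s t : split_filter s = split_filter t -> s = t.
Proof.
move=> st; apply: val_inj; rewrite /= [LHS]surjective_pairing.
rewrite [RHS]surjective_pairing -!/(split_filter _) -!/(split_ideal _).
by rewrite !split_idealE st.
Qed.

Lemma split_filter_move_down s x : minimal_in (split_filter s) x ->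
  split_filter (move_down s x) = split_filter s `\ x.
Proof. by move=> sx; rewrite {1}/split_filter move_downE. Qed.

Lemma generated_split_subproof A :
  `[< is_split ([set u | exists2 v, A v & (v <= u)%O],
        ~` [set u | exists2 v, A v & (v <= u)%O]) >].
Proof.
apply/asboolP; split=> // u w /= uw [v Av vu].
by exists v => //; exact: le_trans uw.
Qed.

Definition generated_split A : FI P := Defs.Split (generated_split_subproof A).

Lemma minimal_generated A x : A x -> (forall v, A v -> (v <= x)%O -> v = x) ->
  minimal_in (split_filter (generated_split A)) x.
Proof.
move=> Ax minx; split; first by exists x.
move=> y [v Av vy] yx; apply/eqP; rewrite eq_le yx /=.
by rewrite -[leLHS](minx v)//; exact: le_trans yx.
Qed.

Lemma minimal_principal x :
  minimal_in (split_filter (generated_split [set x])) x.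
Proof. by apply: minimal_generated => // v ->. Qed.

Lemma covered_by_minimal x y : covered_by x y ->
  minimal_in (split_filter (generated_split [set x]) `\ x) y.
Proof.
move=> [xy ncov]; split.
  by split; [exists x => //; exact: ltW|move=> yx; rewrite yx ltxx in xy].
move=> u [[_ -> xu] ux] uy; have [//|nuy] := eqVneq u y.
case: ncov; exists u; rewrite !lt_neqAle nuy uy xu !andbT eq_sym.
exact/eqP.
Qed.

Lemma minimal_in_setD1 F x y :
  minimal_in F y -> y <> x -> minimal_in (F `\ x) y.
Proof. by move=> [Fy miny] yx; split=> // u [Fu _]; exact: miny. Qed.

(** The only element that can have prevented [y] from being minimal is [x]
itself; when [x <= y], an element strictly between them would lie in the filter
and contradict the minimality of [y] after the removal of [x]. *)
Lemma minimal_in_setD1_inv F x y : is_filter F -> F x ->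
  minimal_in (F `\ x) y -> minimal_in F y \/ covered_by x y.
Proof.
move=> filF Fx [[Fy yx] miny].
have [xy|nxy] := pselect (x <= y)%O.
  right; split; first by rewrite lt_def xy andbT; apply/eqP.
  move=> [z /andP[xz zy]]; have zE : z = y.
    apply: miny (ltW zy); split; first exact: filF (ltW xz) Fx.
    by move=> zx; rewrite zx ltxx in xz.
  by rewrite zE ltxx in zy.
left; split=> // u Fu uy; apply: miny => //; split=> // ux.
by apply: nxy; rewrite -ux.
Qed.

Lemma minimal_in_comparable F x y :
  minimal_in F x -> minimal_in F y -> (x >=< y)%O -> x = y.
Proof.
move=> [Fx minx] [Fy miny] /orP[xy|yx]; first exact: miny.
exact/esym/minx.
Qed.

End SplitTheory.

(** * From the relations to the coloring properties *)

Section RepresentationToColoring.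
Context (R : realType) {d : Order.disp_t} {P : porderType d} {G : finType}.
Variables (adj : rel G) (kappa : P -> G).
Hypothesis X_finite : forall a s, finite_set (X_elements kappa a s).

Notation X := (X R kappa).

(** The removal sequences are recorded as lists, with repetitions, since two
different orders of removal may lead to the same split. *)
Definition successors a (l : seq (FI P)) : seq (FI P) :=
  flatten [seq [seq move_down s x |
                 x <- finmap.enum_fset (fset_set (X_elements kappa a s))]
          | s <- l].

Lemma X_basis_sum a l :
  X a (basis_sum l : V R P) = basis_sum (successors a l).
Proof.
rewrite /basis_sum linear_sum big_flatten big_map; apply: eq_bigr => s _.
by rewrite X_basis big_map (fsbig_finite _ _ (X_finite a s)).
Qed.

Lemma mem_successors a l s x : s \in l -> X_elements kappa a s x ->
  move_down s x \in successors a l.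
Proof.
move=> sl ax; apply/flatten_mapP; exists s => //.
by apply: map_f; rewrite in_fset_set//; exact/mem_set.
Qed.

Lemma X_path2_neq0 a b s x y :
  X_elements kappa a s x -> X_elements kappa b (move_down s x) y ->
  X b (X a (<< s >> : V R P)) <> 0.
Proof.
move=> sx sxy; have -> : << s >> = basis_sum [:: s] :> V R P.
  by rewrite /basis_sum big_seq1.
rewrite !X_basis_sum => /basis_sum_eq0 l0.
have := mem_successors (mem_successors (mem_head s [::]) sx) sxy.
by rewrite l0.
Qed.

Lemma X_path3_neq0 a b c s x y z :
  X_elements kappa a s x -> X_elements kappa b (move_down s x) y ->
  X_elements kappa c (move_down (move_down s x) y) z ->
  X c (X b (X a (<< s >> : V R P))) <> 0.
Proof.
move=> sx sxy sxyz; have -> : << s >> = basis_sum [:: s] :> V R P.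
  by rewrite /basis_sum big_seq1.
rewrite !X_basis_sum => /basis_sum_eq0 l0.
have := mem_successors (mem_successors (mem_successors
  (mem_head s [::]) sx) sxy) sxyz.
by rewrite l0.
Qed.

(** Two incomparable elements of color a are both minimal in the filter that
they generate, and remain so when the other one is removed. *)
Lemma EC_of_representation : square_nilpotent X -> EC kappa.
Proof.
move=> X2 x y kxy; apply/negPn/negP => xy.
have {xy}[xy yx] : ~ (x <= y)%O /\ ~ (y <= x)%O.
  by split=> le; move: xy; rewrite /Order.comparable le ?orbT.
have nyx : y <> x by move=> yx'; apply: xy; rewrite yx'.
pose s : FI P := generated_split [set x; y].
have minx : minimal_in (split_filter s) x.
  by apply: minimal_generated => [|v [|]-> //]; left.
have miny : minimal_in (split_filter s) y.
  by apply: minimal_generated => [|v [|]-> //]; right.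
apply: (@X_path2_neq0 (kappa x) (kappa x) s x y) (X2 _ _); split => //.
by rewrite split_filter_move_down//; exact: minimal_in_setD1.
Qed.

(** The principal filter at [x] has [x] as its only minimal element, so the
color of [y] is available only after the removal of [x]. *)
Lemma adj_of_representation x y : n_relations adj X -> square_nilpotent X ->
  covered_by x y -> adj (kappa x) (kappa y).
Proof.
move=> [dist _] X2 xy; apply/negPn/negP => nadj.
pose s : FI P := generated_split [set x].
have sx : X_elements kappa (kappa x) s x.
  by split=> //; exact: minimal_principal.
have sxy : X_elements kappa (kappa y) (move_down s x) y.
  split=> //; rewrite (split_filter_move_down sx.2).
  exact: covered_by_minimal.
have /= XX := @X_path2_neq0 _ _ s x y sx sxy.
have [kxy|kxy] := eqVneq (kappa x) (kappa y).
  by apply: XX; rewrite kxy; exact: X2.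
have Xy0 : X (kappa y) (<< s >> : V R P) = 0.
  rewrite X_basis (_ : X_elements _ _ _ = set0) ?fsbig_set0//.
  rewrite -subset0 => u [ku [[_ -> xu] minu]].
  have xE := minu x (minimal_principal x).1 xu.
  by move: kxy; rewrite xE ku eqxx.
apply: XX; have := dist (kappa x) (kappa y) _ (<< s >> : V R P).
rewrite /distant kxy nadj => /(_ isT).
by rewrite commutatorE Xy0 linear0 subr0.
Qed.

Lemma NA_of_representation : symmetric adj ->
  n_relations adj X -> square_nilpotent X -> NA adj kappa.
Proof.
move=> adj_sym rel X2 x y [xy|yx]; first exact: adj_of_representation.
by rewrite adj_sym; exact: adj_of_representation.
Qed.

(** The hypothesis on the interval says exactly that [z] becomes minimal in the
principal filter at [x] after the removal of [x] and [y]. *)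
Lemma I3ND_of_representation :
  n_relations adj X -> square_nilpotent X -> I3ND kappa.
Proof.
move=> [_ serre] X2 x y z xy yz xzE; apply/eqP => kxz.
pose s : FI P := generated_split [set x].
have minx := minimal_principal x.
have miny := covered_by_minimal xy.
have [ltxy _] := xy; have [ltyz _] := yz; have ltxz := lt_trans ltxy ltyz.
have minz : minimal_in (split_filter s `\ x `\ y) z.
  split.
    split; first split.
    - by exists x => //; exact: ltW.
    - by move=> zx; rewrite zx ltxx in ltxz.
    - by move=> zy; rewrite zy ltxx in ltyz.
  move=> u [[[_ -> xu] ux] uy] uz.
  have : [set u | x <= u <= z]%O u by rewrite /= xu uz.
  by rewrite xzE => -[[]|].
have sxE := split_filter_move_down minx.
have XX : X (kappa x) (X (kappa y) (X (kappa x) (<< s >> : V R P))) <> 0.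
  apply: (@X_path3_neq0 _ _ _ s x y z); split=> //.
    by rewrite sxE.
  by rewrite split_filter_move_down sxE.
have := serre (kappa x) (kappa y) (<< s >> : V R P).
rewrite serre_square_nilpotent//= => /eqP; rewrite oppr_eq0.
by rewrite -scaler_nat scaler_eq0 pnatr_eq0 /= => /eqP.
Qed.

End RepresentationToColoring.

(** * From the coloring properties to the relations *)

Section ColoringToRepresentation.
Context (R : realType) {d : Order.disp_t} {P : porderType d} {G : finType}.
Variables (adj : rel G) (kappa : P -> G).
Hypotheses (ec : EC kappa) (na : NA adj kappa).

Notation X := (X R kappa).

Lemma X_elements_inj a s x y :
  X_elements kappa a s x -> X_elements kappa a s y -> x = y.
Proof.
move=> [kx minx] [ky miny]; apply: minimal_in_comparable minx miny _.
by apply: ec; rewrite kx.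
Qed.

Lemma X_elements_finite a s : finite_set (X_elements kappa a s).
Proof.
have [[x ax]|a0] := pselect (exists x, X_elements kappa a s x).
  by apply: sub_finite_set (finite_set1 x) => y ay; exact: X_elements_inj ay ax.
rewrite (_ : X_elements _ _ _ = set0)//.
by rewrite -subset0 => x ax; apply: a0; exists x.
Qed.

Lemma X_basis_move a s x : X_elements kappa a s x ->
  X a (<< s >> : V R P) = << move_down s x >>.
Proof.
move=> ax; rewrite X_basis (_ : X_elements _ _ _ = [set x]) ?fsbig_set1//.
by apply/seteqP; split=> [y ay|y ->//]; exact: X_elements_inj ay ax.
Qed.

Lemma X_basis_cases a s :
  (exists2 x, X_elements kappa a s x &
     X a (<< s >> : V R P) = << move_down s x >>)
  \/ X a (<< s >> : V R P) = 0.
Proof.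
have [[x ax]|a0] := pselect (exists x, X_elements kappa a s x).
  by left; exists x => //; exact: X_basis_move.
right; rewrite X_basis (_ : X_elements _ _ _ = set0) ?fsbig_set0//.
by rewrite -subset0 => x ax; apply: a0; exists x.
Qed.

Hypothesis adj_irr : irreflexive adj.

Lemma no_covered_by_same_color x y : kappa x = kappa y -> ~ covered_by x y.
Proof. by move=> kxy xy; have := na (or_introl xy); rewrite kxy adj_irr. Qed.

Lemma X_square_nilpotent : square_nilpotent X.
Proof.
move=> a; apply: (linear_basis_ext (f := X a \o X a) (g := \0)) => s /=.
have [[x [kx minx] ->]|->] := X_basis_cases a s; last by rewrite linear0.
have [[y [ky miny] _]|->//] := X_basis_cases a (move_down s x).
move: miny; rewrite split_filter_move_down// => miny.
have kxy : kappa x = kappa y by rewrite kx.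
case: (minimal_in_setD1_inv (@split_filterP _ _ s) minx.1 miny) => [miny'|xy].
  case: miny => -[_ yx] _; case: yx.
  exact: minimal_in_comparable miny' minx (ec (esym kxy)).
by case: (no_covered_by_same_color kxy xy).
Qed.

(** By NA the element [y] cannot cover [x], so it was already minimal before the
removal of [x], and the two removals can be exchanged. *)
Lemma X_path_swap a b s x y : distant adj a b ->
  X_elements kappa b s x -> X_elements kappa a (move_down s x) y ->
  X a (X b (<< s >> : V R P)) = X b (X a << s >>).
Proof.
move=> /andP[ab nadj] bx ay.
have [kx minx] := bx; have [ky] := ay.
rewrite split_filter_move_down// => miny.
have miny' : minimal_in (split_filter s) y.
  case: (minimal_in_setD1_inv (@split_filterP _ _ s) minx.1 miny) => // xy.
  by move: nadj; rewrite -kx -ky (na (or_intror xy)).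
have xy : x <> y by case: (miny) => -[_ yx] _ /esym.
have bx' : X_elements kappa b (move_down s y) x.
  by split=> //; rewrite split_filter_move_down//; exact: minimal_in_setD1.
rewrite (X_basis_move bx) (X_basis_move ay).
rewrite (@X_basis_move a s y)// (X_basis_move bx'); congr << _ >>.
apply: split_ext; rewrite (split_filter_move_down ay.2).
rewrite (split_filter_move_down bx'.2) !split_filter_move_down//.
by rewrite !setDDl setUC.
Qed.

(** [X_path_swap] applies as soon as one of the two orders of removal is
possible; otherwise both sides vanish. *)
Lemma X_distant_comm a b (v : V R P) : symmetric adj -> distant adj a b ->
  X a (X b v) = X b (X a v).
Proof.
move=> adj_sym ab.
have ba : distant adj b a by rewrite /distant eq_sym adj_sym.
apply: (linear_basis_ext (f := X a \o X b) (g := X b \o X a)) => {v} s /=.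
have [[x bx Xx]|Xb0] := X_basis_cases b s.
  have [[y ay _]|Xa0] := X_basis_cases a (move_down s x).
    exact: X_path_swap bx ay.
  have [[y ay Xy]|Ya0] := X_basis_cases a s; last by rewrite Ya0 Xx Xa0 linear0.
  have [[z bz _]|Yb0] := X_basis_cases b (move_down s y).
    by rewrite (X_path_swap ba ay bz).
  by rewrite Xx Xa0 Xy Yb0.
have [[y ay Xy]|Ya0] := X_basis_cases a s; last by rewrite Ya0 Xb0 !linear0.
have [[z bz _]|Yb0] := X_basis_cases b (move_down s y).
  by rewrite (X_path_swap ba ay bz).
by rewrite Xb0 Xy Yb0 linear0.
Qed.

Hypothesis i3nd : I3ND kappa.

(** [between] says that the removal of [x], [y], [z] in this order leaves room
for nothing but [y] between [x] and [z]; whether or not [y] does lie there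
decides if I3ND or NA is violated. *)
Lemma X_aba_eq0 a b (v : V R P) : X a (X b (X a v)) = 0.
Proof.
apply: (linear_basis_ext (f := X a \o (X b \o X a)) (g := \0)) => {v} s /=.
have [[x [kx minx] ->]|->] := X_basis_cases a s; last by rewrite !linear0.
have [[y [ky miny] ->]|->] := X_basis_cases b (move_down s x);
  last by rewrite linear0.
have [[z [kz minz] _]|->//] := X_basis_cases a (move_down (move_down s x) y).
exfalso; move: minz; rewrite split_filter_move_down// => minz.
move: miny minz; rewrite split_filter_move_down//.
move=> -[[Fy yx] miny] [[[Fz zx] zy] minz].
have kxz : kappa x = kappa z by rewrite kx.
have ltxz : (x < z)%O.
  rewrite lt_neqAle; apply/andP; split; first by apply/eqP => /esym.
  case/orP: (ec kxz) => // zlex; by case: zx; apply: minx.2.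
have between u : (x <= u)%O -> (u <= z)%O -> [\/ u = x, u = y | u = z].
  move=> xu uz; have [->|ux] := pselect (u = x); first by constructor 1.
  have [->|uy] := pselect (u = y); first by constructor 2.
  constructor 3; apply: minz => //; split=> //; split=> //.
  exact: split_filterP xu minx.1.
have [/andP[xy yz]|nxyz] := pselect (x < y < z)%O; last first.
  apply: (no_covered_by_same_color kxz); split=> // -[u /andP[xu uz]].
  case: (between u (ltW xu) (ltW uz)) => uE; rewrite uE ?ltxx// in xu uz.
  by apply: nxyz; rewrite xu uz.
have cxy : covered_by x y.
  split=> // -[u /andP[xu uy]].
  case: (between u (ltW xu) (ltW (lt_trans uy yz))) => uE; subst u.
  - by rewrite ltxx in xu.
  - by rewrite ltxx in uy.
  - by have := lt_trans uy yz; rewrite ltxx.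
have cyz : covered_by y z.
  split=> // -[u /andP[yu uz]].
  case: (between u (ltW (lt_trans xy yu)) (ltW uz)) => uE; subst u.
  - by have := lt_trans xy yu; rewrite ltxx.
  - by rewrite ltxx in yu.
  - by rewrite ltxx in uz.
suff xzE : [set u | x <= u <= z]%O = [set x; y; z].
  by move: (i3nd cxy cyz xzE); rewrite kxz eqxx.
apply/seteqP; split=> u /=.
  case/andP => xu uz; case: (between u xu uz) => ->;
    by [left; left|left; right|right].
by move=> [[]|] ->; rewrite ?lexx ?ltW.
Qed.

End ColoringToRepresentation.

Section XEquivalence.
Context (R : realType) {d : Order.disp_t} {P : porderType d} {G : finType}.
Variables (adj : rel G) (kappa : P -> G).
Hypotheses (adj_sym : symmetric adj) (adj_irr : irreflexive adj).

Lemma X_representation_iff :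
  carries_square_nilpotent_X_rep R kappa adj <->
  [/\ EC kappa, NA adj kappa & I3ND kappa].
Proof.
split=> [[fin rel X2]|[ec na i3nd]].
  split; first exact: EC_of_representation fin X2.
    exact: NA_of_representation fin adj_sym rel X2.
  exact: I3ND_of_representation fin rel X2.
have X2 := X_square_nilpotent (R := R) ec na adj_irr.
split=> //; first exact: X_elements_finite.
split=> [a b ab|a b] v.
  by rewrite commutatorE (X_distant_comm ec na v adj_sym ab) subrr.
rewrite serre_square_nilpotent//.
by rewrite (X_aba_eq0 ec na adj_irr i3nd) mul0rn oppr0.
Qed.

End XEquivalence.

(** * Duality *)

Section Duality.
Context {d : Order.disp_t} {P : porderType d} {G : finType}.
Variables (adj : rel G) (kappa : P -> G).

Notation Pd := (P^d)%type.
Notation kappad := (kappa : Pd -> G).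

Lemma covered_by_dual (x y : P) :
  covered_by (x : Pd) (y : Pd) <-> covered_by y x.
Proof.
by split=> -[xy n]; split=> // -[z]; rewrite andbC => zxy; apply: n; exists z.
Qed.

Lemma coloring_dual : symmetric adj ->
  [/\ EC kappa, NA adj kappa & I3ND kappa] <->
  [/\ EC kappad, NA adj kappad & I3ND kappad].
Proof.
move=> adj_sym.
have ECd : EC kappa <-> EC kappad.
  split=> ec x y kxy.
    exact: ec (esym kxy).
  exact: ec (esym kxy).
have NAd : NA adj kappa <-> NA adj kappad.
  split=> na x y.
    by move=> [] /covered_by_dual xy; apply: na; [right|left].
  by move=> [] /covered_by_dual xy; apply: na; [right|left].
have intd (x y z : P) : [set u | x <= u <= z]%O = [set x; y; z] <->
    [set u : Pd | ((z : Pd) <= u <= (x : Pd))%O] = [set z; y; x].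
  have -> : [set u : Pd | ((z : Pd) <= u <= (x : Pd))%O] =
      [set u | x <= u <= z]%O.
    by apply/seteqP; split=> u /=; rewrite andbC.
  rewrite (_ : [set z; y; x] = [set x; y; z])//.
  by rewrite setUC setUA setUAC setUC setUA.
have I3d : I3ND kappa <-> I3ND kappad.
  split=> i3nd x y z.
    move=> /covered_by_dual yx /covered_by_dual zy /intd xzE.
    by rewrite eq_sym; exact: i3nd xzE.
  move=> /covered_by_dual yx /covered_by_dual zy /intd xzE.
  by rewrite eq_sym; exact: i3nd xzE.
by split=> -[? ? ?]; split; tauto.
Qed.

Lemma dual_split_subproof (s : FI P) :
  `[< is_split (P := Pd) (split_ideal s, split_filter s) >].
Proof.
apply/asboolP; split=> /= [x y yx|]; rewrite split_idealE ?setCK// => nsx sy.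
by apply: nsx; exact: (@split_filterP _ _ s) yx sy.
Qed.

Definition dual_split (s : FI P) : FI Pd := Defs.Split (dual_split_subproof s).

(** The inverse of [dual_split] is not [dual_split] for the poset [P^d]: the
dual of [P^d] has the order of [P] but not its display. *)
Lemma undual_split_subproof (s : FI Pd) :
  `[< is_split (P := P) (split_ideal s, split_filter s) >].
Proof.
apply/asboolP; split=> /= [x y yx|]; rewrite split_idealE ?setCK// => nsx sy.
by apply: nsx; exact: (@split_filterP _ _ s) yx sy.
Qed.

Definition undual_split (s : FI Pd) : FI P :=
  Defs.Split (undual_split_subproof s).

Lemma dual_splitK : cancel dual_split undual_split.
Proof. by move=> s; apply: val_inj; case: s => -[]. Qed.

Lemma undual_splitK : cancel undual_split dual_split.
Proof. by move=> s; apply: val_inj; case: s => -[]. Qed.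

Lemma Y_elements_dual a s :
  Y_elements kappa a s = X_elements kappad a (dual_split s).
Proof. by []. Qed.

Lemma dual_split_move_up (s : FI P) y : maximal_in (split_ideal s) y ->
  dual_split (move_up s y) = move_down (dual_split s) (y : Pd).
Proof.
move=> maxy; apply: val_inj.
rewrite [RHS](@move_downE _ Pd (dual_split s) y maxy) /=.
by rewrite /split_ideal /split_filter move_upE.
Qed.

Section Operators.
Variable R : realType.

Definition dual_map : {linear V R P -> V R Pd} :=
  linear_extension (fun s => << dual_split s >> : V R Pd).

Definition undual_map : {linear V R Pd -> V R P} :=
  linear_extension (fun s => << undual_split s >> : V R P).

Lemma dual_map_basis s : dual_map << s >> = << dual_split s >>.
Proof. exact: linear_extensionE. Qed.

Lemma undual_map_basis s : undual_map << s >> = << undual_split s >>.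
Proof. exact: linear_extensionE. Qed.

Lemma dual_mapK : cancel dual_map undual_map.
Proof.
apply: (linear_basis_ext (f := undual_map \o dual_map) (g := idfun)) => s /=.
by rewrite dual_map_basis undual_map_basis dual_splitK.
Qed.

Lemma undual_mapK : cancel undual_map dual_map.
Proof.
apply: (linear_basis_ext (f := dual_map \o undual_map) (g := idfun)) => s /=.
by rewrite undual_map_basis dual_map_basis undual_splitK.
Qed.

Lemma dual_map_Y (fin : forall a s, finite_set (Y_elements kappa a s)) a v :
  dual_map (Y R kappa a v) = X R kappad a (dual_map v).
Proof.
move: v; apply: (linear_basis_ext (f := dual_map \o Y R kappa a)
  (g := X R kappad a \o dual_map)) => s /=.
rewrite dual_map_basis X_basis Y_basis -Y_elements_dual.
rewrite !fsbig_finite//= linear_sum; apply: eq_big_seq => y.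
rewrite in_fset_set// => /set_mem[_ maxy].
by rewrite dual_map_basis dual_split_move_up.
Qed.

Lemma Y_representation_dual :
  carries_square_nilpotent_Y_rep R kappa adj <->
  carries_square_nilpotent_X_rep R kappad adj.
Proof.
have finE : (forall a s, finite_set (Y_elements kappa a s)) <->
    (forall a s, finite_set (X_elements kappad a s)).
  split=> fin a s; last exact: (fin a (dual_split s)).
  by rewrite -[s]undual_splitK -Y_elements_dual.
split=> -[fin rel nil].
  have [] := conjugate_relations undual_mapK (dual_map_Y fin) (conj rel nil).
  by split=> //; exact/finE.
have {}fin := finE.2 fin.
have DX a v : undual_map (X R kappad a v) = Y R kappa a (undual_map v).
  by rewrite -{1}[v]undual_mapK -dual_map_Y// dual_mapK.
by have [] := conjugate_relations dual_mapK DX (conj rel nil).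
Qed.

End Operators.

End Duality.

Theorem theorem5p5 (R : realType)
    (G : finType) (adj : rel G)
    (adj_sym : symmetric adj) (adj_irr : irreflexive adj)
    (d : Order.disp_t) (P : porderType d)
    (P_locally_finite : locally_finite_poset P)
    (kappa : P -> G) (kappa_surj : forall a, exists x, kappa x = a) :
  [<-> carries_square_nilpotent_X_rep R kappa adj;
       [/\ EC kappa, NA adj kappa & I3ND kappa];
       carries_square_nilpotent_Y_rep R kappa adj].
Proof.
have Xiff := X_representation_iff R kappa adj_sym adj_irr.
have Yiff : carries_square_nilpotent_Y_rep R kappa adj <->
    [/\ EC kappa, NA adj kappa & I3ND kappa].
  apply: iff_trans (Y_representation_dual adj kappa R) _.
  apply: iff_trans (iff_sym (coloring_dual kappa adj_sym)).
  exact: X_representation_iff.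
by tfae; [move/Xiff|move/Yiff|move/Yiff/Xiff].
Qed.
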